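(* Let $d$ be a positive integer that is not a perfect square and let $z$ be an integer. Then: 1. $Q_{2^n}(d,z)$, $n\ge 0$, are the Newton approximations of $\sqrt d$ with initial condition $z$; that is, $Q_{2^n}(d,z)=x_n$ for every $n\ge0$, where $x_0=z$ and $x_n=\dfrac{x_{n-1}^2+d}{2x_{n-1}}$ for $n\ge1$. 2. For every $n\ge0$, $Q_{2n+1}(d,z)$ is the Padé approximation of $\sqrt d$ centered in $z^2$ and of degree $n$, where $Q_{2n+1}(d,z)$ and $\sqrt d$ are regarded as functions of the variable $d$ with $z$ fixed.
   Context: For an integer $z$, set $N_n(d,z)=\sum_{i\ge 0}\binom{n}{2i}d^iz^{n-2i}$ and $D_n(d,z)=\sum_{i\ge 0}\binom{n}{2i+1}d^iz^{n-2i-1}$ (terms with zero binomial coefficient are omitted), so that $(z+\sqrt d)^n=N_n(d,z)+D_n(d,z)\sqrt d$. These are polynomials in $d$ for fixed $z$. The Rédei rational functions are $Q_n(d,z)=N_n(d,z)/D_n(d,z)$ for $n\ge1$. The Newton approximations of $\sqrt d$ are the iterates of Newton's method applied to $f(x)=x^2-d$. The Padé approximation of degree $n$ of a function $f$ centered in $c$ is the ratio $P/R$ of polynomials $P,R$ of degree at most $n$, with $R(c)\ne0$, such that the Taylor series of $f-P/R$ at $c$ has only terms of order at least $2n+1$.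
   Formalization: In part 2 the square root is the branch with value z at z²: √d for z>0 and −√d for z<0 (with +√d, n=0 fails as Q_1=z≠√(z²)); z=0 is excluded in part 2 since √d has no Taylor series at 0. In part 1 with z=0, where the iterates are undefined, x/0=0 is used. *)

(* Defs.v *)
From HB Require Import structures.
From mathcomp Require Import all_boot all_order all_algebra.
From mathcomp Require Import all_classical all_reals all_analysis.

Set Implicit Arguments.
Unset Strict Implicit.
Unset Printing Implicit Defensive.

Import Order.TTheory GRing.Theory Num.Theory.
Import numFieldNormedType.Exports.

Local Open Scope classical_set_scope.
Local Open Scope ring_scope.

(* The polynomials N_n and D_n with
     (z + sqrt d) ^+ n = N_n(d, z) + D_n(d, z) * sqrt d.
   The arguments d and z range over an arbitrary ring, so that d may be a
   number as well as an indeterminate. *)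
Definition redeiN (A : comNzRingType) (n : nat) (d z : A) : A :=
  \sum_(i < n.+1 | (i.*2 <= n)%N)
     'C(n, i.*2)%:R * d ^+ i * z ^+ (n - i.*2)%N.

Definition redeiD (A : comNzRingType) (n : nat) (d z : A) : A :=
  \sum_(i < n.+1 | (i.*2.+1 <= n)%N)
     'C(n, i.*2.+1)%:R * d ^+ i * z ^+ (n - i.*2.+1)%N.

Definition redeiQ (F : fieldType) (n : nat) (d z : F) : F :=
  redeiN n d z / redeiD n d z.

(* Q_n(d, z) as a rational function of d over R, for a fixed integer z. *)
Definition redeiQ_fun (R : fieldType) (n : nat) (z : int) :
    {fraction {poly R}} :=
  redeiQ n (FracField.tofrac ('X : {poly R})) z%:~R.

Definition newton_step (F : fieldType) (f : {poly F}) (x : F) : F :=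
  x - f.[x] / (deriv f).[x].

Definition newton (F : fieldType) (f : {poly F}) (x0 : F) (n : nat) : F :=
  iter n (newton_step f) x0.

(* [derive1n] is total, so the existence of all the derivatives at c has to be
   required separately for the Taylor series at c to be meaningful. *)
Definition has_taylor_series (R : realType) (f : R -> R) (c : R) : Prop :=
  forall k : nat, \forall x \near c, derivable (derive1n k f) x 1.

Definition taylor_coef (R : realType) (f : R -> R) (c : R) (k : nat) : R :=
  derive1n k f c / (k`!)%:R.

(* The approximation is the ratio P / Q itself, an element of the field of
   rational functions: P and Q need not be in lowest terms. *)
Definition is_pade_approx (R : realType) (f : R -> R) (c : R) (n : nat)
    (g : {fraction {poly R}}) : Prop :=
  exists P Q : {poly R},
    [/\ (size P <= n.+1)%N, (size Q <= n.+1)%N, Q.[c] != 0,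
        g = FracField.tofrac P / FracField.tofrac Q &
        let e := fun t : R => f t - P.[t] / Q.[t] in
        has_taylor_series e c /\
        forall k : nat, (k < n.*2.+1)%N -> taylor_coef e c k = 0].

Definition is_the_pade_approx (R : realType) (f : R -> R) (c : R) (n : nat)
    (g : {fraction {poly R}}) : Prop :=
  is_pade_approx f c n g /\
  forall h : {fraction {poly R}}, is_pade_approx f c n h -> h = g.

(* Main.v *)
Require Import Defs.
From HB Require Import structures.
From mathcomp Require Import all_boot all_order all_algebra.
From mathcomp Require Import all_classical all_reals all_analysis.
From mathcomp Require Import zify ring.

Set Implicit Arguments.
Unset Strict Implicit.
Unset Printing Implicit Defensive.

Import Order.TTheory GRing.Theory Num.Theory.
Import numFieldNormedType.Exports.

Local Open Scope ring_scope.

(* The Newton step sends N/D to (N^2 + d D^2) / (2 N D), which is the quotient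
   attached to (N + D sqrt d)^2; hence doubling the exponent of z + sqrt d is
   one Newton step.

   For the Padé part let s be the branch of the square root with s(z^2) = z.
   Then s - N/D = - (z - s)^(2n+1) / D, and z - s = (z^2 - t) / (z + s) vanishes
   to first order at t = z^2. *)

(** * Calculus of functions that are smooth near a point or vanish there to a given order *)

Section Jets.
Variables (R : realType) (c : R).
Implicit Types (f g h : R -> R) (b : bool) (k : nat).

(* [f] is k times differentiable near [c] and, if [b] holds, its derivatives of
   order less than k vanish at [c]. *)
Fixpoint jet b k f : Prop :=
  if k is k'.+1 then
    [/\ b -> f c = 0, \forall x \near c, derivable f x (1 : R)
      & jet b k' (derive1 f)]
  else True.

(** Bridge from the recursion, which suits inductions with differentiation rules, to the iterated
    derivatives used in Taylor coefficients. *)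
Lemma jetP b k f :
  jet b k f <-> forall i, (i < k)%N ->
    (\forall x \near c, derivable (derive1n i f) x (1 : R)) /\
    (b -> derive1n i f c = 0).
Proof.
elim: k f => [|k IH] f //=; split.
  case=> f0 df /IH jf' [|i] ik; first by split.
  by rewrite derive1Sn; apply: jf'.
move=> H; have [df f0] := H 0%N isT; split=> //.
by apply/IH => i ik; rewrite -derive1Sn; exact: H.
Qed.

Lemma near_eq_jet b k f g : (\forall x \near c, f x = g x) ->
  jet b k f -> jet b k g.
Proof.
elim: k f g => [|k IH] f g //= fg [f0 df jf'].
(* Equality near [c] is also equality near each point close to [c], so the derivatives agree on a
   neighbourhood and not only at [c]. *)
have fg2 := near_join fg.
split; first by move=> /f0 <-; rewrite (nbhs_singleton fg).
  by apply: filterS2 fg2 df => x; apply: near_eq_derivable.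
apply: IH jf'; apply: filterS fg2 => x fgx.
by rewrite !derive1E; apply: near_eq_derive.
Qed.

Lemma jetSI b k f g : (b -> f c = 0) ->
  (\forall x \near c, is_derive x (1 : R) f (g x)) -> jet b k g -> jet b k.+1 f.
Proof.
move=> f0 fg jg; split=> //; first by apply: filterS fg => x [].
apply: near_eq_jet jg; apply: filterS fg => x [_ <-].
by rewrite derive1E.
Qed.

Lemma jetS_is_derive b k f : jet b k.+1 f ->
  \forall x \near c, is_derive x (1 : R) f (derive1 f x).
Proof.
by case=> _ df _; apply: filterS df => x df; split=> //; rewrite derive1E.
Qed.

Lemma jetW b k f : jet b k.+1 f -> jet b k f.
Proof. by move=> /jetP H; apply/jetP => i ik; apply: H; apply: ltnW. Qed.

Lemma jetD b k f g : jet b k f -> jet b k g -> jet b k (fun x => f x + g x).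
Proof.
elim: k f g => [|k IH] f g // jf jg.
case: (jf) (jg) => f0 _ jf' [g0 _ jg'].
apply: (@jetSI _ _ _ (fun x => derive1 f x + derive1 g x)); last exact: IH.
  by move=> b1; rewrite f0 // g0 // addr0.
apply: filterS2 (jetS_is_derive jf) (jetS_is_derive jg) => x df dg.
exact: is_deriveD.
Qed.

(** By the Leibniz rule each term of the derivative keeps a factor [f] or [derive1 f] that inherits
    the vanishing, so [g] has to be smooth only. *)
Lemma jetM b k f g :
  jet b k f -> jet false k g -> jet b k (fun x => f x * g x).
Proof.
elim: k f g => [|k IH] f g // jf jg.
case: (jf) (jg) => f0 _ jf' [_ _ jg'].
apply: (@jetSI _ _ _ (fun x => f x * derive1 g x + derive1 f x * g x)).
- by move=> /f0 ->; rewrite mul0r.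
- apply: filterS2 (jetS_is_derive jf) (jetS_is_derive jg) => x df dg.
  by rewrite [derive1 f x * _]mulrC; exact: is_deriveM.
- by apply: jetD; apply: IH => //; exact: jetW.
Qed.

Lemma jet_horner k (p : {poly R}) : jet false k (fun x => p.[x]).
Proof.
elim: k p => [|k IH] p //; apply: jetSI (IH p^`()%R) => //.
by apply: (@nearW _ (nbhs c)) => x; exact: is_derive_poly.
Qed.

Lemma jet_cst k a : jet false k (fun=> a).
Proof.
apply: near_eq_jet (jet_horner k a%:P).
by apply: (@nearW _ (nbhs c)) => x; rewrite hornerC.
Qed.

Lemma jetN b k f : jet b k f -> jet b k (fun x => - f x).
Proof.
move=> jf; apply: near_eq_jet (jetM jf (jet_cst k (-1))).
by apply: (@nearW _ (nbhs c)) => x; rewrite mulrN1.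
Qed.

Lemma jetB b k f g : jet b k f -> jet b k g -> jet b k (fun x => f x - g x).
Proof. by move=> jf /jetN; exact: jetD. Qed.

Lemma jetX k f m : jet false k f -> jet false k (fun x => f x ^+ m).
Proof.
move=> jf; elim: m => [|m IH]; first exact: jet_cst.
by apply: near_eq_jet (jetM jf IH);
  apply: (@nearW _ (nbhs c)) => x; rewrite exprS.
Qed.

Lemma jet_neq0 k f : jet false k.+1 f -> f c != 0 ->
  \forall x \near c, f x != 0.
Proof.
case=> _ df _ fc.
have /derivable1_diffP/differentiable_continuous cf := nbhs_singleton df.
apply: (@cvgr_neq0 _ _ _ _ (nbhs_filter c) f (f c) cf fc).
Qed.

(** The derivative [- f' / f ^+ 2] involves the inverse of [f] only to one order less, which the
    induction supplies. *)
Lemma jetV k f : f c != 0 -> jet false k f -> jet false k (fun x => (f x)^-1).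
Proof.
move=> fc; elim: k f fc => [|k IH] f fc // jf.
have fV := IH _ fc (jetW jf).
case: (jf) => _ _ jf'.
apply: (@jetSI _ _ _ (fun x => - (derive1 f x * ((f x)^-1 * (f x)^-1)))) => //.
  apply: filterS2 (jetS_is_derive jf) (jet_neq0 jf fc) => x df fx.
  apply: DeriveDef; first by apply: derivableV => //; case: df.
  rewrite deriveV //.
  by rewrite derive_val scaleNr [in RHS]mulrC -invfM -expr2.
by apply: jetN; apply: jetM => //; apply: jetM.
Qed.

(* [s' = 1 / (2 s)], so each derivative of [s] is bought by the previous one. *)
Lemma jet_sqrt k (s : R -> R) : s c != 0 ->
  (\forall x \near c, is_derive x (1 : R) s (2 * s x)^-1) -> jet false k s.
Proof.
move=> sc ds; elim: k => [|k IH] //.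
apply: jetSI ds _ => //; apply: jetV; first by rewrite mulf_neq0 ?pnatr_eq0.
by apply: jetM => //; exact: jet_cst.
Qed.

Lemma jet_subX m : jet true m (fun x => (x - c) ^+ m).
Proof.
(* The induction runs over all multiples of the power, a class that differentiation maps into the
   one of exponent one less. *)
have H p : ('X - c%:P) ^+ m %| p -> jet true m (horner p).
  elim: m p => [|m IH] p // dvd.
  apply: jetSI (IH p^`()%R _); last first.
  - have /dvdpP[q ->] := dvd.
    rewrite derivM deriv_exp derivXsubC mul1r mulrnAr -mulrnAl exprS /=.
    by rewrite mulrA dvdp_add ?dvdp_mull.
  - by apply: (@nearW _ (nbhs c)) => x; exact: is_derive_poly.
  - move=> _; have /dvdpP[q ->] := dvd.
    by rewrite !hornerE subrr expr0n mulr0.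
apply: near_eq_jet (H _ (dvdpp _)).
by apply: (@nearW _ (nbhs c)) => x; rewrite !hornerE.
Qed.

Lemma jet_horner_eq0 m (p : {poly R}) : (size p <= m)%N ->
  jet true m (horner p) -> p = 0.
Proof.
elim: m p => [|m IH] p sp.
  by move=> _; apply/eqP; rewrite -size_poly_leq0.
case=> /(_ isT) pc _; have -> : derive1 (horner p) = horner p^`()%R.
  by apply/funext => x; rewrite derive1E derive_val.
have sp' : (size p^`()%R <= m)%N.
  have [->|p0] := eqVneq p 0; first by rewrite deriv0 size_poly0.
  by rewrite -ltnS (leq_trans (lt_size_deriv p0)).
move=> /(IH _ sp') dp0; have : (size p <= 1)%N.
  rewrite leqNgt; apply/negP => sp1.
  have := coef_deriv p (size p).-2; rewrite dp0 coef0 => /esym/eqP.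
  rewrite -mulr_natr mulf_eq0 pnatr_eq0 orbF prednK -?subn1 ?subn_gt0 // subn1.
  by rewrite -lead_coefE lead_coef_eq0 => /eqP p0; rewrite p0 size_poly0 in sp1.
by move=> /size1_polyC pE; move: pc; rewrite pE hornerC => ->.
Qed.

End Jets.

(** * Algebraic identities and degrees of the Rédei polynomials *)

Section Redei.

(** Serves both for evaluating polynomials and for embedding them into the rational functions. *)
Lemma redeiN_rmorph (A B : comNzRingType) (f : {rmorphism A -> B}) n (d z : A) :
  f (redeiN n d z) = redeiN n (f d) (f z).
Proof.
rewrite rmorph_sum; apply: eq_bigr => i _.
by rewrite !rmorphM !rmorphXn rmorph_nat.
Qed.

Lemma redeiD_rmorph (A B : comNzRingType) (f : {rmorphism A -> B}) n (d z : A) :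
  f (redeiD n d z) = redeiD n (f d) (f z).
Proof.
rewrite rmorph_sum; apply: eq_bigr => i _.
by rewrite !rmorphM !rmorphXn rmorph_nat.
Qed.

Lemma sum_even_odd (V : nmodType) (F : nat -> V) m :
  \sum_(i < m.*2) F i = \sum_(i < m) F i.*2 + \sum_(i < m) F i.*2.+1.
Proof.
elim: m => [|m IH]; first by rewrite !big_ord0 addr0.
by rewrite doubleS !big_ord_recr /= IH -!addrA; congr (_ + _); rewrite addrCA.
Qed.

Lemma redei_expr (A : comNzRingType) n (z s : A) :
  (z + s) ^+ n = redeiN n (s ^+ 2) z + redeiD n (s ^+ 2) z * s.
Proof.
rewrite exprDn; pose F i := z ^+ (n - i) * s ^+ i *+ 'C(n, i).
(* Padding with vanishing binomials makes the range split into [n.+1] even and [n.+1] odd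
   indices. *)
have widen : \sum_(i < n.+1) F i = \sum_(i < n.+1.*2) F i.
  rewrite (big_ord_widen n.+1.*2 F); last by rewrite -addnn leq_addr.
  rewrite big_mkcond; apply: eq_bigr => i _; case: ltnP => // ni.
  by rewrite /F bin_small.
rewrite [LHS]widen sum_even_odd /redeiN /redeiD mulr_suml.
rewrite [X in _ = X + _]big_mkcond [X in _ = _ + X]big_mkcond /=.
congr (_ + _); apply: eq_bigr => i _; rewrite /F -mulr_natl;
  [case: (leqP i.*2) | case: (leqP i.*2.+1)] => ni.
- by rewrite -mul2n exprM; ring.
- by rewrite bin_small // mul0r.
- by rewrite exprS -mul2n exprM; ring.
- by rewrite bin_small // mul0r.
Qed.

(** As [s] lies in the field, coefficients of [1] and [s] cannot be compared directly; adding and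
    subtracting the expansions at [s] and [- s] separates them. *)
Lemma redei_double (F : numFieldType) m (z s : F) : s != 0 ->
  redeiN m.*2 (s ^+ 2) z
    = redeiN m (s ^+ 2) z ^+ 2 + s ^+ 2 * redeiD m (s ^+ 2) z ^+ 2 /\
  redeiD m.*2 (s ^+ 2) z = 2 * redeiN m (s ^+ 2) z * redeiD m (s ^+ 2) z.
Proof.
move=> s0; have := redei_expr m.*2 z s; have := redei_expr m.*2 z (- s).
rewrite -mul2n mulnC !exprM !(redei_expr m) !sqrrN.
move: (redeiN m _ _) (redeiD m _ _) => n d.
move: (redeiN _ _ _) (redeiD _ _ _) => N D.
move=> eqN eqP.
have two0 : 2 != 0 :> F by rewrite pnatr_eq0.
split.
  apply: (mulfI two0).
  have -> : 2 * N = (N + D * s) + (N + D * - s) by ring.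
  by rewrite -eqP -eqN; ring.
apply: (mulfI two0); apply: (mulIf s0).
have -> : 2 * D * s = (N + D * s) - (N + D * - s) by ring.
by rewrite -eqP -eqN; ring.
Qed.

(** If this value were 0, the powers of [z + z] and [z - z] would coincide, forcing [z = 0]. It
    makes the denominator nonzero at the Padé centre. *)
Lemma redeiD_sqr_neq0 (F : numFieldType) m (z : F) : z != 0 ->
  redeiD m.+1 (z ^+ 2) z != 0.
Proof.
move=> z0; apply/eqP => D0.
have := redei_expr m.+1 z z; have := redei_expr m.+1 z (- z).
rewrite !sqrrN D0 !mul0r subrr expr0n => <- /eqP.
by rewrite expf_eq0 -mulr2n mulrn_eq0 (negPf z0).
Qed.

Lemma size_redeiN (A : comNzRingType) n (z : A) :
  (size (redeiN n 'X z%:P) <= n./2.+1)%N.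
Proof.
apply: (leq_trans (size_sum _ _ _)); apply/bigmax_leqP => i ni.
rewrite -rmorphXn -polyC_natr mulrAC -rmorphM mul_polyC.
apply: (leq_trans (size_scale_leq _ _)).
by rewrite size_polyXn ltnS -(doubleK i) half_leq.
Qed.

Lemma size_redeiD (A : comNzRingType) n (z : A) :
  (size (redeiD n 'X z%:P) <= n.-1./2.+1)%N.
Proof.
apply: (leq_trans (size_sum _ _ _)); apply/bigmax_leqP => i ni.
rewrite -rmorphXn -polyC_natr mulrAC -rmorphM mul_polyC.
apply: (leq_trans (size_scale_leq _ _)).
by rewrite size_polyXn ltnS -(doubleK i) half_leq //
  -ltnS (leq_trans ni) // leqSpred.
Qed.

End Redei.

(** * Padé approximation: uniqueness, and existence for a branch of the square root *)

Section Pade.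
Variables (R : realType) (c : R).

Lemma taylor_jet k (e : R -> R) : has_taylor_series e c ->
  (forall i, (i < k)%N -> taylor_coef e c i = 0) -> jet c true k e.
Proof.
move=> he Te; apply/jetP => i ik; split=> [|_]; first exact: he.
have /eqP := Te i ik.
by rewrite mulf_eq0 invr_eq0 pnatr_eq0 eqn0Ngt fact_gt0 orbF => /eqP.
Qed.

Lemma jet_taylor k (e : R -> R) : (forall m, jet c false m e) ->
  jet c true k e ->
  has_taylor_series e c /\ forall i, (i < k)%N -> taylor_coef e c i = 0.
Proof.
move=> je jet0; split=> [i|i ik]; first by have /jetP/(_ i)[] := je i.+1.
by have /jetP/(_ i ik)[_ /(_ isT) e0] := jet0; rewrite /taylor_coef e0 mul0r.
Qed.

(* Two approximants differ by a function that vanishes to order 2n + 1 at c;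
   clearing denominators leaves a polynomial of degree at most 2n. *)
Lemma pade_unique (f : R -> R) n g h :
  is_pade_approx f c n g -> is_pade_approx f c n h -> h = g.
Proof.
move=> [P [Q [sP sQ Qc -> [he e0]]]] [P' [Q' [sP' sQ' Qc' -> [he' e0']]]].
have Qn0 : Q != 0 by apply: contraNneq Qc => ->; rewrite horner0.
have Qn0' : Q' != 0 by apply: contraNneq Qc' => ->; rewrite horner0.
apply/eqP; rewrite eqr_div ?tofrac_eq0 // -!tofracM tofrac_eq -subr_eq0.
apply/eqP/(@jet_horner_eq0 R c n.*2.+1).
  have sM (p q : {poly R}) : (size p <= n.+1)%N -> (size q <= n.+1)%N ->
      (size (p * q)%R <= n.*2.+1)%N.
    move=> sp sq; apply: (leq_trans (size_polyMleq _ _)).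
    by lia.
  by rewrite (leq_trans (size_polyD _ _)) // size_polyN geq_max !sM.
have je := taylor_jet he e0.
have je' := taylor_jet he' e0'.
(* The function [f] cancels in the difference of the errors; near [c], where [Q] and [Q'] are
   nonzero, the product is the polynomial [P' * Q - P * Q']. *)
have := jetM (jetB je je') (jet_horner c n.*2.+1 (Q * Q')).
have Qnear : \forall x \near c, Q.[x] != 0 := jet_neq0 (jet_horner c 1 Q) Qc.
have Qnear' : \forall x \near c, Q'.[x] != 0 :=
  jet_neq0 (jet_horner c 1 Q') Qc'.
apply: near_eq_jet; apply: filterS2 Qnear Qnear' => x Qx Qx'.
by rewrite hornerD hornerN !hornerM; field; rewrite Qx Qx'.
Qed.

(** The branch [s] is abstract so as to cover both signs of [z]. *)
Lemma pade_redei (s : R -> R) (z : int) n : z != 0 -> c = (z ^+ 2)%:~R ->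
  s c = z%:~R ->
  (\forall x \near c, is_derive x (1 : R) s (2 * s x)^-1) ->
  (\forall x \near c, s x ^+ 2 = x) ->
  is_the_pade_approx s c n (redeiQ_fun R n.*2.+1 z).
Proof.
move=> z0 cz sc ds s2; pose Z : R := z%:~R.
have Z0 : Z != 0 by rewrite intr_eq0.
have cZ : c = Z ^+ 2 by rewrite cz rmorphXn.
suff pade : is_pade_approx s c n (redeiQ_fun R n.*2.+1 z).
  by split=> // h; exact: pade_unique.
pose N := redeiN n.*2.+1 'X Z%:P; pose D := redeiD n.*2.+1 'X Z%:P.
have NE t : N.[t] = redeiN n.*2.+1 t Z.
  have := redeiN_rmorph (horner_eval t) n.*2.+1 'X Z%:P.
  by rewrite /= /horner_eval hornerX hornerC.
have DE t : D.[t] = redeiD n.*2.+1 t Z.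
  have := redeiD_rmorph (horner_eval t) n.*2.+1 'X Z%:P.
  by rewrite /= /horner_eval hornerX hornerC.
have Dc : D.[c] != 0.
  by rewrite DE cZ redeiD_sqr_neq0.
have js k : jet c false k s by apply: jet_sqrt => //; rewrite sc.
exists N, D; split=> //.
- by rewrite (leq_trans (size_redeiN _ _)) // ltnS; lia.
- by rewrite (leq_trans (size_redeiD _ _)) // ltnS; lia.
- rewrite /redeiQ_fun /redeiQ redeiN_rmorph redeiD_rmorph /= /Z.
  by rewrite !rmorph_int.
apply: jet_taylor => [m|].
  apply: jetB => //.
  apply: jetM (jet_horner _ _ _) (jetV Dc (jet_horner _ _ _)).
(* Near [c] the error is [(t - c) ^+ n.*2.+1 * g t], and [g] is smooth there because
   [Z + s c = 2 * Z] and [D.[c]] are nonzero. *)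
pose g t := ((Z + s t) ^+ n.*2.+1 * D.[t])^-1.
have Zs : Z + s c != 0 by rewrite sc -mulr2n mulrn_eq0.
have jZs k : jet c false k (fun t => Z + s t).
  by apply: jetD => //; exact: jet_cst.
have jg : jet c false n.*2.+1 g.
  apply: jetV; first by rewrite mulf_neq0 ?expf_neq0.
  by apply: jetM (jet_horner _ _ _); apply: jetX.
apply: near_eq_jet (jetM (jet_subX c n.*2.+1) jg).
have Dnear : \forall x \near c, D.[x] != 0 := jet_neq0 (jet_horner c 1 D) Dc.
apply: filterS3 Dnear (jet_neq0 (jZs 1%N) Zs) s2 => t Dt Zt st.
have := redei_expr n.*2.+1 Z (- s t); rewrite sqrrN st -NE -DE => E.
rewrite /g invfM mulrA -exprVn -exprMn cZ.
have -> : (t - Z ^+ 2) / (Z + s t) = - (Z - s t) by rewrite -{1}st; field.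
(* The exponent is odd, so the sign survives and gives [- (N - D * s) / D = s - N / D]. *)
rewrite exprNn -signr_odd /= odd_double expr1 mulN1r E.
by field.
Qed.

End Pade.

(* At x = 0 both sides are 0, since division by 0 yields 0. *)
Lemma newton_step_sqrt (F : numFieldType) (d x : F) :
  newton_step ('X^2 - d%:P) x = (x ^+ 2 + d) / (2 * x).
Proof.
rewrite /newton_step !poly.derivE !hornerE subr0 -mulr2n -[x *+ 2]mulr_natl.
have [->|x0] := eqVneq x 0; first by rewrite !(mulr0, invr0, subr0).
by field.
Qed.

Lemma redeiQ_double (F : numFieldType) m (z s : F) : s != 0 ->
  redeiQ m.*2 (s ^+ 2) z
    = (redeiQ m (s ^+ 2) z ^+ 2 + s ^+ 2) / (2 * redeiQ m (s ^+ 2) z).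
Proof.
move=> s0; rewrite /redeiQ; have [-> ->] := redei_double m z s0.
move: (redeiN _ _ _) (redeiD _ _ _) => N D.
(* If [N] or [D] is 0, both sides are 0 because division by 0 yields 0. *)
have [->|N0] := eqVneq N 0; first by rewrite !(mul0r, mulr0, invr0).
have [->|D0] := eqVneq D 0; first by rewrite !(mulr0, invr0).
by field; rewrite N0 D0.
Qed.

Lemma redei1 (A : comNzRingType) (d z : A) :
  redeiN 1 d z = z /\ redeiD 1 d z = 1.
Proof.
by split; rewrite /redeiN /redeiD big_mkcond !big_ord_recl big_ord0 /=
  !(bin0, bin1, expr0, expr1, mulr1, mul1r, addr0).
Qed.

(** Doubling turns the pair into a sum of two nonzero squares, positive in an ordered field, and a
    product of nonzero factors. Hence for [z != 0] the Newton recursion never divides by 0. *)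
Lemma redei_pow2_neq0 (R : realFieldType) (z s : R) n : s != 0 -> z != 0 ->
  redeiN (2 ^ n) (s ^+ 2) z != 0 /\ redeiD (2 ^ n) (s ^+ 2) z != 0.
Proof.
move=> s0 z0; elim: n => [|n [N0 D0]].
  by have [-> ->] := redei1 (s ^+ 2) z; rewrite oner_neq0.
rewrite expnS mul2n; have [-> ->] := redei_double (2 ^ n) z s0.
split; last by rewrite !mulf_neq0 ?pnatr_eq0.
by rewrite lt0r_neq0 // -exprMn addr_gt0 // exprn_even_gt0 //= mulf_neq0.
Qed.

Theorem theorem2 (R : realType) (d z : int)
    (d_gt0 : 0 < d) (d_nonsquare : forall m : int, d != m ^+ 2) :
  [/\ forall n : nat,
        redeiQ (2 ^ n)%N (d%:~R : R) z%:~R =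
        newton ('X^2 - (d%:~R)%:P) z%:~R n,
      forall x : nat -> R,
        x 0%N = z%:~R ->
        (forall n : nat, x n.+1 = (x n ^+ 2 + d%:~R) / (2 * x n)) ->
        (forall n : nat, redeiQ (2 ^ n)%N d%:~R z%:~R = x n) /\
        (z != 0 -> forall n : nat,
           redeiD (2 ^ n)%N (d%:~R : R) z%:~R != 0 /\ x n != 0),
      0 < z -> forall n : nat,
        is_the_pade_approx (fun t : R => Num.sqrt t) (z ^+ 2)%:~R n
          (redeiQ_fun R n.*2.+1 z)
    & z < 0 -> forall n : nat,
        is_the_pade_approx (fun t : R => - Num.sqrt t) (z ^+ 2)%:~R n
          (redeiQ_fun R n.*2.+1 z)].
Proof.
set dR := d%:~R : R; set zR := z%:~R : R.
have d0 : 0 < dR by rewrite ltr0z.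
have [s s0 ds] : exists2 s : R, s != 0 & dR = s ^+ 2.
  by exists (Num.sqrt dR); rewrite ?sqr_sqrtr ?gt_eqF ?sqrtr_gt0 // ltW.
have Q0 : redeiQ (2 ^ 0) dR zR = zR.
  by rewrite /redeiQ; have [-> ->] := redei1 dR zR; rewrite divr1.
have QS n : redeiQ (2 ^ n.+1) dR zR
    = (redeiQ (2 ^ n) dR zR ^+ 2 + dR) / (2 * redeiQ (2 ^ n) dR zR).
  by rewrite expnS mul2n ds redeiQ_double.
have [z0 sqrt_is_derive] : (z != 0 -> 0 < zR ^+ 2) /\ forall x : R, 0 < x ->
    is_derive x (1 : R) Num.sqrt (2 * Num.sqrt x)^-1.
  by split=> [z0|]; [rewrite exprn_even_gt0 //= intr_eq0
                 | exact: is_derive1_sqrt].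
have near_gt0 : z != 0 -> \forall x \near ((z ^+ 2)%:~R : R), 0 < x.
  by move=> /z0; rewrite -rmorphXn; exact: lt_nbhsr.
split.
- elim=> [|n IH]; first by rewrite Q0.
  by rewrite QS IH /newton iterS newton_step_sqrt.
- move=> x x0 xS; have Qx n : redeiQ (2 ^ n) dR zR = x n.
    by elim: n => [|n IH]; [rewrite Q0 x0 | rewrite QS IH xS].
  split=> // zn0 n; have zR0 : zR != 0 by rewrite intr_eq0.
  have [N0 D0] := redei_pow2_neq0 n s0 zR0.
  by rewrite -Qx /redeiQ ds; split=> //; rewrite mulf_neq0 ?invr_neq0.
- move=> z_gt0 n; have zn0 : z != 0 by rewrite gt_eqF.
  apply: pade_redei => //.
  + by rewrite rmorphXn sqrtr_sqr gtr0_norm // ltr0z.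
  + by apply: filterS (near_gt0 zn0) => x; exact: sqrt_is_derive.
  + by apply: filterS (near_gt0 zn0) => x /ltW; exact: sqr_sqrtr.
- move=> z_lt0 n; have zn0 : z != 0 by rewrite lt_eqF.
  apply: pade_redei => //.
  + by rewrite rmorphXn sqrtr_sqr ltr0_norm ?opprK // ltrz0.
  (* The opposite branch satisfies the same equation [s' = 1 / (2 * s)], since both sides change
     sign. *)
  + apply: filterS (near_gt0 zn0) => x /sqrt_is_derive dx.
    by rewrite mulrN invrN; exact: is_deriveN.
  + by apply: filterS (near_gt0 zn0) => x /ltW x0; rewrite sqrrN sqr_sqrtr.
Qed.
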